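(* Let $1 \le k < N$ be integers, and for sequences $(r_i)_{i\ge1}$, $(\ell_i)_{i\ge1}$ let $X\subset\mathbb{R}^N$ be the compact set constructed from them as described in the context. Then there exists an open set $\mathcal{U} \subset \mathrm{Lip}(X,\mathbb{R}^k)$ containing all full-rank linear maps $L \in \mathrm{Lin}(\mathbb{R}^N,\mathbb{R}^k)$ restricted to $X$, such that the following hold. (i) For $r_i = 2^{-i}$ and $\ell_i = 2^{-i^2}$, we have $\dim_H X = 0$ and no map $\phi \in \mathcal{U}$ is injective on $X$ with a pointwise $\alpha$-Hölder inverse for any $\alpha > 0$. (ii) For every $s \in (0,k)$ and $t = \frac{k}{k-s}$, $r_i = 2^{-i}$, $\ell_i = 2^{-it}$, we have $\underline{\dim}_B X = \overline{\dim}_B X = s$ and no map $\phi \in \mathcal{U}$ is injective on $X$ with a pointwise $\alpha$-Hölder inverse for $\alpha > 1 - \frac{\overline{\dim}_B X}{k}$. In particular, if $\mu$ is a finite Borel measure supported on $X$ with $\mu(\{x\}) > 0$ for every $x \in X$, then in both cases, for $\phi \in \mathcal{U}$, there is no full $\mu$-measure set on which $\phi$ is injective with a pointwise $\alpha$-Hölder inverse for $\alpha$ in the given range.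
   Context: Construction of $X$ (which, as well as $\mathcal{U}$, depends on the chosen sequences). Let $(r_i)_{i\ge1}$, $(\ell_i)_{i\ge1}$ be sequences of positive real numbers decreasing to $0$ with $\ell_i \le r_i$. Let $\mathcal{J} = \{J\subset\{1,\ldots,N\} : \#J = k+1\}$, and for $J\in\mathcal{J}$ let $S_J = \{(x_1,\ldots,x_N)\in\mathbb{R}^N : \sum_{j\in J} x_j^2 = 1 \text{ and } x_j = 0 \text{ for } j\notin J\}$ be a $k$-dimensional unit sphere. For $J\in\mathcal{J}$ and $i\ge1$ let $X_{J,i}$ be an $\ell_i$-separated set of maximal cardinality in $r_iS_J = \{r_ix : x\in S_J\}$ (distinct points at distance at least $\ell_i$). Put $X_J = \bigcup_{i=1}^\infty X_{J,i}\cup\{0\}$ and $X = \bigcup_{J\in\mathcal{J}} X_J$. $\mathrm{Lip}(X,\mathbb{R}^k)$ is the space of Lipschitz functions $h\colon X\to\mathbb{R}^k$ with the norm $\|h\|_{\mathrm{Lip}} = \|h\|_\infty+\mathrm{Lip}(h)$ (supremum norm plus Lipschitz constant). A map $\psi\colon A\to\mathbb{R}^N$, $A\subset\mathbb{R}^k$, is pointwise $\alpha$-Hölder if for every $x\in A$ there exists $c_x>0$ such that $\|\psi(x)-\psi(y)\|\le c_x\|x-y\|^\alpha$ for every $y\in A$. $\dim_H$ is the Hausdorff dimension; with $N(X,\delta)$ the minimal number of balls of radius $\delta$ needed to cover $X$, the lower and upper box-counting dimensions $\underline{\dim}_B X$, $\overline{\dim}_B X$ are the $\liminf$ and $\limsup$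 as $\delta\to0$ of $\frac{\log N(X,\delta)}{-\log\delta}$. *)

(* Defs.v *)
From HB Require Import structures.
From mathcomp Require Import all_boot all_order all_algebra.
From mathcomp Require Import all_classical all_reals all_analysis.

Set Implicit Arguments.
Unset Strict Implicit.
Unset Printing Implicit Defensive.

Import Order.TTheory GRing.Theory Num.Theory.
Import numFieldTopology.Exports numFieldNormedType.Exports.

Local Open Scope classical_set_scope.
Local Open Scope ring_scope.

(* The library norm `|x| on 'rV[R]_n is the sup norm; [enorm] is the Euclidean
   one. Both induce the library topology. *)
Definition enorm (R : realType) (n : nat) (x : 'rV[R]_n) : R :=
  Num.sqrt (\sum_(i < n) x 0 i ^+ 2).

(* The Borel sigma-algebra of R^n. *)
Definition borel_rV (R : realType) (n : nat) :=
  g_sigma_algebraType (@open 'rV[R]_n).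

Section dimensions.
Context {R : realType} {n : nat}.
Implicit Types (s d : R) (A E : set 'rV[R]_n).

(* The diameter of the empty set is -oo. *)
Definition diam A : \bar R :=
  ereal_sup [set (enorm (x - y))%:E | x in A & y in A].

(* diam(A)^s, where the empty set counts for 0 even if s = 0. *)
Definition diam_pow s A : \bar R :=
  (if A == set0 then 0 else poweR (diam A) s)%E.

(* H^s_d(E): infimum over countable covers by arbitrary sets of diameter at
   most d. *)
Definition hausdorff_premeasure s d E : \bar R :=
  ereal_inf [set (\sum_(0 <= i <oo) diam_pow s (V i))%E |
    V in [set V : nat -> set 'rV[R]_n |
      E `<=` \bigcup_i V i /\ forall i, (diam (V i) <= d%:E)%E]].

Definition hausdorff_measure s E : \bar R :=
  ereal_sup [set hausdorff_premeasure s d E | d in [set d : R | 0 < d]].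

Definition hausdorff_dim E : \bar R :=
  ereal_inf [set s%:E | s in [set s : R |
    0 <= s /\ hausdorff_measure s E = 0%E]].

(* The balls are closed, with centers anywhere in R^n; the value is +oo if
   there is no finite cover. *)
Definition covering_number E d : \bar R :=
  ereal_inf [set (m%:R)%:E | m in [set m : nat |
    exists c : 'I_m -> 'rV[R]_n,
      E `<=` \bigcup_i [set x | enorm (x - c i) <= d]]].

Definition box_ratio E d : \bar R :=
  (lne (covering_number E d) * ((- ln d)^-1)%:E)%E.

Definition lower_box_dim E : \bar R := limf_einf (box_ratio E) 0^'+.

Definition upper_box_dim E : \bar R := limf_esup (box_ratio E) 0^'+.

End dimensions.

Section lipschitz_space.
Context {R : realType} {n k : nat} (X : set 'rV[R]_n).
Implicit Types (h g : X -> 'rV[R]_k) (U : set (X -> 'rV[R]_k)).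

(* The underlying set of Lip(X, R^k); for bounded X its elements are
   bounded functions. *)
Definition lip_space : set (X -> 'rV[R]_k) :=
  [set h | exists c : R, forall x y : X,
    enorm (h x - h y) <= c * enorm (val x - val y)].

Definition lip_sup_norm h : \bar R :=
  ereal_sup [set (enorm (h x))%:E | x in [set: X]].

(* The pairs with x = y contribute 0 / 0 = 0. *)
Definition lip_const h : \bar R :=
  ereal_sup [set (enorm (h x - h y) / enorm (val x - val y))%:E |
    x in [set: X] & y in [set: X]].

Definition lip_norm h : \bar R := (lip_sup_norm h + lip_const h)%E.

(* U is an open subset of the normed space Lip(X, R^k). *)
Definition lip_open U : Prop :=
  U `<=` lip_space /\
  forall h, U h -> exists2 e : R, 0 < e &
    forall g, lip_space g -> (lip_norm (g \- h)%R < e%:E)%E -> U g.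

End lipschitz_space.

Definition pointwise_holder (R : realType) (m n : nat) (a : R)
    (A : set 'rV[R]_m) (psi : 'rV[R]_m -> 'rV[R]_n) : Prop :=
  forall x, A x -> exists2 c : R, 0 < c &
    forall y, A y -> enorm (psi x - psi y) <= c * enorm (x - y) `^ a.

(* The inverse is defined on the image of A; psi extends it arbitrarily. *)
Definition injective_with_holder_inverse (R : realType) (n k : nat)
    (X : set 'rV[R]_n) (a : R) (phi : X -> 'rV[R]_k) (A : set X) : Prop :=
  {in A &, injective phi} /\
  exists psi : 'rV[R]_k -> 'rV[R]_n,
    (forall x : X, A x -> psi (phi x) = val x) /\
    pointwise_holder a (phi @` A) psi.

(* A is (the trace on X of) a set of full mu-measure. *)
Definition full_measure_in (R : realType) (n : nat)
    (mu : {finite_measure set (borel_rV R n) -> \bar R})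
    (X : set 'rV[R]_n) (A : set X) : Prop :=
  mu.-negligible (~` (val @` A) : set (borel_rV R n)).

Definition supported_with_atoms (R : realType) (n : nat)
    (mu : {finite_measure set (borel_rV R n) -> \bar R})
    (X : set 'rV[R]_n) : Prop :=
  mu (~` X) = 0%E /\ forall x, X x -> (0 < mu [set x])%E.

Section construction.
Context {R : realType} {n : nat}.

Definition coord_sphere (J : {set 'I_n}) : set 'rV[R]_n :=
  [set x | \sum_(j in J) x 0 j ^+ 2 = 1 /\ forall j, j \notin J -> x 0 j = 0].

Definition separated_in (d : R) (S A : set 'rV[R]_n) : Prop :=
  A `<=` S /\ forall x y, A x -> A y -> x != y -> d <= enorm (x - y).

Definition max_card_separated_in (d : R) (S A : set 'rV[R]_n) : Prop :=
  separated_in d S A /\ forall B, separated_in d S B -> (B #<= A)%card.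

(* X is a set obtained from the sequences r and l for some choice P of the
   separated sets. The sequences are used at indices i >= 1 only. *)
Definition layered_set (k : nat) (r l : nat -> R) (X : set 'rV[R]_n) : Prop :=
  exists P : {set 'I_n} -> nat -> set 'rV[R]_n,
    (forall (J : {set 'I_n}) (i : nat), #|J| = k.+1 -> (1 <= i)%N ->
      max_card_separated_in (l i) [set r i *: x | x in coord_sphere J] (P J i))
    /\ X = \bigcup_(J in [set J : {set 'I_n} | #|J| = k.+1])
             (\bigcup_(i in [set i : nat | (1 <= i)%N]) P J i `|` [set 0]).

End construction.

Definition admissible_sequences (R : realType) (r l : nat -> R) : Prop :=
  [/\ forall i, (1 <= i)%N -> 0 < l i <= r i,
      forall i j, (1 <= i <= j)%N -> r j <= r i /\ l j <= l i,
      r @ \oo --> (0 : R)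
    & l @ \oo --> (0 : R)].

(* Main.v *)
(** A full-rank [L] restricted to a suitable R^J with #|J| = k + 1 has a
    one-dimensional kernel. If [phi - L] has a small Lipschitz constant, a
    discrete contraction on the net X_{J,i} near that kernel line finds a point
    of norm [r i] whose image is within [C * l i] of [phi 0]. A pointwise
    alpha-Hoelder inverse at the single point [phi 0] thus forces
    [r i <= c * (l i) `^ alpha] for all [i], which fails for the given rates.
    Atoms at every point make every set of full measure equal to X.

    For the box dimension, put sigma = s / k: then [r i = (l i) `^ (1 - sigma)],
    so the layer [i] needs about (r i / max (l i) d)^k <= d^(-s) balls of
    radius d, and there are O(log (1 / d)) layers outside the ball of radius d
    at the origin. *)

Require Import Defs.
From HB Require Import structures.
From mathcomp Require Import all_boot all_order all_algebra.
From mathcomp Require Import all_classical all_reals all_analysis.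
From mathcomp Require Import ring lra.

Set Implicit Arguments.
Unset Strict Implicit.
Unset Printing Implicit Defensive.

Import Order.TTheory GRing.Theory Num.Theory.
Import numFieldTopology.Exports numFieldNormedType.Exports.

Local Open Scope classical_set_scope.
Local Open Scope ring_scope.

(** * Comparison of the Euclidean norm with the sup norm *)

Section norms.
Variables (R : realType).

Lemma row_norm_le n (x : 'rV[R]_n) (c : R) :
  0 <= c -> (forall i, `|x 0 i| <= c) -> `|x| <= c.
Proof.
move=> c0 xc; rewrite [`|x|]mx_normrE; apply: bigmax_le => // -[i j] _ /=.
by rewrite ord1.
Qed.

Lemma coord_le_norm n (x : 'rV[R]_n) i : `|x 0 i| <= `|x|.
Proof.
rewrite [leRHS]mx_normrE.
exact: (le_bigmax _ (fun ij : 'I_1 * 'I_n => `|x ij.1 ij.2|) (0, i)).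
Qed.

Lemma enorm_ge0 n (x : 'rV[R]_n) : 0 <= enorm x.
Proof. exact: sqrtr_ge0. Qed.

Lemma sqr_enorm n (x : 'rV[R]_n) : enorm x ^+ 2 = \sum_(i < n) x 0 i ^+ 2.
Proof. by rewrite sqr_sqrtr// sumr_ge0// => i _; exact: sqr_ge0. Qed.

Lemma norm_le_enorm n (x : 'rV[R]_n) : `|x| <= enorm x.
Proof.
apply: row_norm_le => [|i]; first exact: enorm_ge0.
rewrite -(@ler_pXn2r _ 2)// ?nnegrE ?enorm_ge0// sqr_enorm.
rewrite real_normK ?num_real// (bigD1 i)//= lerDl sumr_ge0// => j _.
exact: sqr_ge0.
Qed.

(** Each of the [n] squares is at most the square of the sup norm, and n <= n^2. The crude factor
    [n] reappears in the constants below. *)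
Lemma enorm_le_norm n (x : 'rV[R]_n) : enorm x <= n%:R * `|x|.
Proof.
rewrite -(@ler_pXn2r _ 2)// ?nnegrE ?enorm_ge0// ?mulr_ge0// sqr_enorm.
apply: (@le_trans _ _ (n%:R * `|x| ^+ 2)).
  rewrite -[n in n%:R]card_ord mulr_natl -sumr_const ler_sum// => i _.
  by rewrite -[leLHS]real_normK ?num_real// ler_sqr ?nnegrE// coord_le_norm.
rewrite exprMn ler_wpM2r ?sqr_ge0//.
by case: n x => [|n] x; rewrite ?expr0n// ler_eXnr// ler1n.
Qed.

Lemma enorm0 n : enorm (0 : 'rV[R]_n) = 0.
Proof.
by rewrite /enorm big1 ?sqrtr0// => i _; rewrite mxE expr0n.
Qed.

Lemma norm_mulmx_le n m (A : 'M[R]_(n, m)) :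
  exists2 c : R, 0 < c & forall x : 'rV_n, `|x *m A| <= c * `|x|.
Proof.
exists (1 + \sum_(i < n) \sum_(j < m) `|A i j|).
  by rewrite ltr_wpDr// sumr_ge0// => i _; rewrite sumr_ge0.
move=> x; apply: row_norm_le => [|j].
  by rewrite mulr_ge0// addr_ge0// sumr_ge0// => i _; rewrite sumr_ge0.
rewrite mxE (le_trans (ler_norm_sum _ _ _))// mulrDl mul1r ler_wpDl//.
rewrite mulr_suml ler_sum// => i _; rewrite normrM mulrC.
rewrite ler_pM ?coord_le_norm//.
by rewrite (bigD1 j)//= lerDl sumr_ge0.
Qed.

End norms.

(** * Full-rank matrices on coordinate spheres and the discrete contraction *)

(** Full rank yields an invertible k x k minor of [A], with row set [J0]. Adding one index [j0]
    leaves room in R^J for a kernel vector: the j0-th basis vector corrected by a combination of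
    coordinates in [J0]. *)
Lemma kernel_frame (R : realType) (n k : nat) (A : 'M[R]_(n, k)) :
  (k < n)%N -> \rank A = k ->
  exists (J : {set 'I_n}) (v : 'rV[R]_n) (M : 'M[R]_(k, n)),
  [/\ #|J| = k.+1, coord_sphere J v /\ v *m A = 0, M *m A = 1%:M,
      M *m v^T = 0 & forall i j, j \notin J -> M i j = 0].
Proof.
move=> kn rkA.
have fA : row_full A by rewrite /row_full rkA.
pose f := fullrankfun fA.
have finj : injective f by exact: fullrankfun_inj.
pose J0 : {set 'I_n} := (f @: predT)%SET.
have cJ0 : #|J0| = k by rewrite card_imset// card_ord.
have [j0 j0J] : exists j0, j0 \notin J0.
  apply/existsP; apply: contraLR kn => /existsPn J0T.
  rewrite -leqNgt -cJ0 -[leqLHS]card_ord -cardsT; apply/subset_leq_card/fintype.subsetP.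
  by move=> j _; apply/negPn/J0T.
pose J := (j0 |: J0)%SET.
pose S : 'M[R]_(k, n) := \matrix_(i, j) (f i == j)%:R.
have SA : S *m A = rowsub f A.
  apply/matrixP => i j; rewrite !mxE (bigD1 (f i))//= mxE eqxx mul1r big1 ?addr0//.
  by move=> x /negPf xf; rewrite mxE eq_sym xf mul0r.
pose M0 := invmx (rowsub f A) *m S.
have M0A : M0 *m A = 1%:M by rewrite -mulmxA SA mulVmx ?fullrowsub_unit.
have M0J i j : j \notin J0 -> M0 i j = 0.
  move=> jJ; rewrite mxE big1// => x _; rewrite mxE.
  case: eqP => [fx|_]; last by rewrite mulr0.
  by rewrite -fx imset_f in jJ.
pose v0 : 'rV[R]_n := delta_mx 0 j0 - row j0 A *m M0.
have v0A : v0 *m A = 0.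
  by rewrite mulmxBl -mulmxA M0A mulmx1 -rowE subrr.
have v0j0 : v0 0 j0 = 1.
  rewrite !mxE !eqxx big1 ?subr0// => x _.
  by rewrite M0J// mulr0.
have v0J j : j \notin J -> v0 0 j = 0.
  rewrite in_setU1 negb_or => /andP[/negPf jj0 jJ].
  rewrite !mxE jj0 andbF sub0r big1 ?oppr0// => x _.
  by rewrite M0J// mulr0.
pose q := \sum_j v0 0 j ^+ 2.
have q_gt0 : 0 < q.
  rewrite /q (bigD1 j0)//= v0j0 expr1n ltr_wpDr//.
  by apply: sumr_ge0 => i _; exact: sqr_ge0.
pose v := (Num.sqrt q)^-1 *: v0.
have vJ j : j \notin J -> v 0 j = 0 by move=> /v0J vj; rewrite mxE vj mulr0.
have vv : v *m v^T = 1%:M.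
  apply/matrixP => i j; rewrite !ord1 mxE [RHS]mxE eqxx /=.
  under eq_bigr do rewrite [v^T _ _]mxE [v 0 _]mxE -expr2 exprMn.
  by rewrite -mulr_sumr exprVn sqr_sqrtr ?ltW// mulVf// gt_eqF.
(* The rows of [M0] are projected orthogonally to the unit vector [v]. As [v *m A = 0], this keeps a
   left inverse of [A]. *)
exists J, v, (M0 - (M0 *m v^T) *m v); split.
- by rewrite cardsU1 j0J cJ0.
- split; last by rewrite -scalemxAl v0A scaler0.
  split=> //; have <- : (v *m v^T) 0 0 = 1 by rewrite vv mxE.
  rewrite mxE.
  rewrite [RHS](bigID (mem J)) /= [X in _ = _ + X]big1 ?addr0.
    by apply: eq_bigr => j _; rewrite [v^T _ _]mxE expr2.
  by move=> j /vJ vj; rewrite vj mul0r.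
- by rewrite mulmxBl -(mulmxA _ v A) -scalemxAl v0A scaler0 mulmx0 subr0.
- by rewrite mulmxBl -(mulmxA _ v) vv mulmx1 subrr.
- move=> i j jJ; rewrite mxE M0J.
    by rewrite [X in 0 + X]mxE [X in - X]mxE big_ord1 (vJ j)// mulr0 oppr0 addr0.
  by move: jJ; rewrite in_setU1 negb_or => /andP[].
Qed.

Section sphere.
Variables (R : realType) (n : nat).
Implicit Types (J : {set 'I_n}) (r : R) (x y : 'rV[R]_n).

(** The dilate r S_J for [r > 0], described by [enorm]; [scaled_coord_sphere] is the
    identification. *)
Definition sphere J r : set 'rV[R]_n :=
  [set y | enorm y = r /\ forall j, j \notin J -> y 0 j = 0].

Lemma sum_sqr_supp J x : (forall j, j \notin J -> x 0 j = 0) ->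
  \sum_(j in J) x 0 j ^+ 2 = \sum_j x 0 j ^+ 2.
Proof.
move=> xJ; rewrite [RHS](bigID (mem J))/= [X in _ = _ + X]big1 ?addr0//.
by move=> j /xJ ->; rewrite expr0n.
Qed.

Lemma scaled_coord_sphere J r : 0 < r ->
  [set r *: x | x in coord_sphere J] = sphere J r.
Proof.
move=> r0; apply/seteqP; split => [_ [x [x1 xJ]] <-|y [yr yJ]].
  split=> [|j /xJ xj]; last by rewrite mxE xj mulr0.
  rewrite /enorm; under eq_bigr do rewrite mxE exprMn.
  by rewrite -mulr_sumr -(sum_sqr_supp xJ) x1 mulr1 sqrtr_sqr gtr0_norm.
exists (r^-1 *: y); last by rewrite scalerA mulfV ?scale1r// gt_eqF.
split=> [|j /yJ yj]; last by rewrite mxE yj mulr0.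
under eq_bigr do rewrite mxE exprMn.
by rewrite -mulr_sumr (sum_sqr_supp yJ) -sqr_enorm yr exprVn mulVf// sqrf_eq0 gt_eqF.
Qed.

Lemma sphere_norm_le J r y : sphere J r y -> `|y| <= r.
Proof. by case=> <- _; exact: norm_le_enorm. Qed.

End sphere.

(** Iteration gives [d i <= 2 * a + d 0 / 2 ^+ i]; the third [a] pays for the transient term once
    2^i exceeds [d 0 / a]. *)
Lemma halving_recursion (R : realType) (a : R) (d : nat -> R) : 0 < a ->
  (forall i, d i.+1 <= a + d i / 2) -> exists i, d i <= 3 * a.
Proof.
move=> a0 da.
have dle i : d i <= 2 * a + d 0%N / 2 ^+ i.
  elim: i => [|i IH]; first by rewrite expr0 divr1; lra.
  rewrite exprS invfM mulrCA; have := da i; lra.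
exists (Num.truncn (d 0%N / a)).+1; set i := (Num.truncn _).+1.
have : d 0%N / 2 ^+ i <= a.
  rewrite ler_pdivrMr ?exprn_gt0// mulrC -ler_pdivrMr//.
  rewrite (le_trans (ltW (truncnS_gt _)))// -/i -natrX ler_nat ltnW//.
  exact: ltn_expl.
have := dle i; lra.
Qed.

(* [sigma w = w *m M + sqrt (r^2 - |w *m M|^2) *: v], where the unit vector [v]
   spans the kernel of [A] in R^J. *)
Lemma sphere_section (R : realType) (n k : nat) (A : 'M[R]_(n, k))
    (J : {set 'I_n}) (v : 'rV[R]_n) (M : 'M[R]_(k, n)) :
  (0 < n)%N ->
  coord_sphere J v -> v *m A = 0 -> M *m A = 1%:M -> M *m v^T = 0 ->
  (forall i j, j \notin J -> M i j = 0) ->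
  exists rho K : R, [/\ 0 < rho, 0 < K & forall r, 0 < r ->
    exists sigma : 'rV[R]_k -> 'rV[R]_n,
    [/\ forall w : 'rV[R]_k, `|w| <= rho * r -> sphere J r (sigma w),
        forall w, sigma w *m A = w
      & forall w w' : 'rV[R]_k, `|w| <= rho * r -> `|w'| <= rho * r ->
          `|sigma w - sigma w'| <= K * `|w - w'|]].
Proof.
move=> n0 Sv vA MA Mv MJ.
have [m m0 Mm] := norm_mulmx_le M.
have nR : 0 < n%:R :> R by rewrite ltr0n.
have vsph : sphere J 1 v.
  by rewrite -scaled_coord_sphere//; exists v => //; rewrite scale1r.
(* This [rho] forces |w M| <= r / (2n), hence Euclidean norm at most r / 2, so the square root stays
   away from 0. In [2 * m], one [m] bounds the change of [w *m M] and the other the change of the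
   coefficient of [v]. *)
exists (2 * n%:R * m)^-1, (2 * m); split.
- by rewrite invr_gt0 !mulr_gt0.
- by rewrite mulr_gt0.
move=> r r0.
pose q (u : 'rV[R]_n) := \sum_j u 0 j ^+ 2.
pose sigma (w : 'rV[R]_k) : 'rV[R]_n := w *m M + Num.sqrt (r ^+ 2 - q (w *m M)) *: v.
have small (w : 'rV[R]_k) : `|w| <= (2 * n%:R * m)^-1 * r -> `|w *m M| <= r / (2 * n%:R).
  move=> wr; rewrite (le_trans (Mm w))// (le_trans (ler_wpM2l (ltW m0) wr))//.
  by rewrite mulrA invfM mulrCA mulfV ?gt_eqF// mulr1 mulrC.
have qsmall u : `|u| <= r / (2 * n%:R) -> q u <= r ^+ 2 / 4.
  move=> ur; rewrite /q -sqr_enorm.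
  rewrite [leRHS](_ : _ = (r / 2) ^+ 2); last by field.
  rewrite ler_sqr ?nnegrE ?enorm_ge0//; last by lra.
  rewrite (le_trans (enorm_le_norm _))// (le_trans (ler_wpM2l (ltW nR) ur))//.
  by rewrite invfM mulrCA (mulrCA n%:R) mulfV ?gt_eqF// mulr1.
exists sigma; split.
- move=> w /small/qsmall wr; split => [|j jJ]; last first.
    rewrite !mxE big1 => [|i _]; last by rewrite MJ// mulr0.
    by rewrite add0r vsph.2// mulr0.
  rewrite /enorm (_ : \sum_j _ = r ^+ 2) ?sqrtr_sqr ?gtr0_norm//.
  have uv : \sum_j (w *m M) 0 j * v 0 j = 0.
    transitivity ((w *m M *m v^T) 0 0); last by rewrite -mulmxA Mv mulmx0 mxE.
    by rewrite [RHS]mxE; apply: eq_bigr => j _; rewrite [v^T _ _]mxE.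
  pose t := Num.sqrt (r ^+ 2 - q (w *m M)).
  (* Pythagoras: the cross term vanishes because the rows of [M] are orthogonal to [v]. *)
  transitivity (q (w *m M) + t * (2 * \sum_j (w *m M) 0 j * v 0 j) +
      t ^+ 2 * \sum_j v 0 j ^+ 2).
    rewrite !mulr_sumr -!big_split/=; apply: eq_bigr => j _.
    by rewrite [sigma w _ _]mxE [(_ *: v) _ _]mxE -/t; ring.
  rewrite uv -sqr_enorm vsph.1 sqr_sqrtr; first by ring.
  by rewrite subr_ge0 (le_trans wr)// ler_pdivrMr// ler_peMr ?sqr_ge0// ler1n.
- by move=> w; rewrite mulmxDl -mulmxA MA mulmx1 -scalemxAl vA scaler0 addr0.
- move=> w w' /small wr /small w'r.
  set u := w *m M in wr; set u' := w' *m M in w'r.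
  have uu' : `|u - u'| <= m * `|w - w'| by rewrite -mulmxBl Mm.
  pose t x := Num.sqrt (r ^+ 2 - q x).
  have tge x : `|x| <= r / (2 * n%:R) -> r / 2 <= t x /\ t x ^+ 2 = r ^+ 2 - q x.
    move=> /qsmall xr; have r20 : 0 <= r ^+ 2 by exact: sqr_ge0.
    split; last by rewrite sqr_sqrtr//; lra.
    rewrite -[leLHS]gtr0_norm ?divr_gt0// -sqrtr_sqr ler_wsqrtr// exprMn exprVn.
    lra.
  have [t1 e1] := tge _ wr; have [t2 e2] := tge _ w'r.
  have qq : `|q u' - q u| <= r * `|u - u'|.
    rewrite -sumrB (le_trans (ler_norm_sum _ _ _))//.
    apply: (@le_trans _ _ (\sum_(j < n) (r / n%:R) * `|u - u'|)); last first.
      rewrite sumr_const card_ord -[leLHS]mulr_natl.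
      rewrite (_ : _ * _ = r * `|u - u'|)//.
      by field; rewrite gt_eqF.
    apply: ler_sum => j _; rewrite subr_sqr normrM mulrC ler_pM//.
      rewrite (le_trans (ler_normD _ _))// [leRHS](_ : _ = r / (2 * n%:R) + r / (2 * n%:R)).
        by rewrite lerD// (le_trans (coord_le_norm _ _)).
      by field; rewrite gt_eqF.
    by rewrite distrC; have := coord_le_norm (u - u') j; rewrite !mxE.
  (* The difference of the square roots is the difference of their squares divided by [t u + t u'],
     which is at least [r]. *)
  have tt : `|t u - t u'| <= `|u - u'|.
    rewrite -(ler_pM2l r0) (le_trans _ qq)//.
    have -> : q u' - q u = (t u + t u') * (t u - t u') by lra.
    by rewrite normrM ler_wpM2r// ger0_norm; lra.
  have -> : sigma w - sigma w' = (u - u') + (t u - t u') *: v.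
    by rewrite /sigma -/u -/u' scalerBl opprD addrACA.
  rewrite (le_trans (ler_normD _ _))// normrZ.
  have : `|t u - t u'| * `|v| <= `|u - u'| * 1.
    by rewrite ler_pM// (sphere_norm_le vsph).
  lra.
Qed.

(* Perturbations [x |-> x *m A + G x] of [A], with [G] having a small Lipschitz
   constant on a net of a sphere in R^J, almost return to their value at [0]. *)
Definition forces_almost_zero (R : realType) (n k : nat) (A : 'M[R]_(n, k))
    (J : {set 'I_n}) (e C : R) : Prop :=
  forall (r l : R) (P : set 'rV[R]_n), 0 < r -> 0 < l -> P `<=` sphere J r ->
  (forall x, sphere J r x -> exists2 p, P p & `|x - p| <= l) ->
  forall G : 'rV[R]_n -> 'rV[R]_k,
  (forall x y, (P `|` [set 0]) x -> (P `|` [set 0]) y ->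
    `|G x - G y| <= e * `|x - y|) ->
  exists2 p, P p & `|p *m A + (G p - G 0)| <= C * l.

(* Discrete contraction: [w] is sent to minus the increment of [G] at a net
   point near the lift of [w]; a nearly stationary iterate gives the point. *)
Lemma exists_forces_almost_zero (R : realType) (n k : nat) (A : 'M[R]_(n, k)) :
  (k < n)%N -> \rank A = k ->
  exists (J : {set 'I_n}) (e C : R),
  [/\ #|J| = k.+1, 0 < e, 0 < C & forces_almost_zero A J e C].
Proof.
move=> kn rkA.
have [J [v [M [cJ [Sv vA] MA Mv MJ]]]] := kernel_frame kn rkA.
have [rho [K [rho0 K0 sec]]] :=
  sphere_section (leq_ltn_trans (leq0n _) kn) Sv vA MA Mv MJ.
have [a a0 Aa] := norm_mulmx_le A.
(* The bound [rho] keeps the iteration in the ball where the section is controlled; [(2 * K)^-1]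
   gives contraction factor 1/2. *)
pose e := Num.min rho (2 * K)^-1.
have e0 : 0 < e by rewrite lt_min rho0 invr_gt0 mulr_gt0.
have erho : e <= rho by rewrite ge_min lexx.
have eK : e * K <= 1 / 2.
  rewrite -ler_pdivlMr// (_ : 1 / 2 / K = (2 * K)^-1) ?ge_min ?lexx ?orbT//.
  by rewrite invfM mul1r.
(* The term [a] comes from replacing a lift by a net point at distance [l]; [6 * e] is three times
   the additive error [2 * e * l] of the recursion. *)
exists J, e, (a + 6 * e); split=> //; first by rewrite addr_gt0// mulr_gt0.
move=> r l P r0 l0 Psph net G GP.
have [sigma [sph sA slip]] := sec r r0.
have /choice[p pP] : forall w : 'rV[R]_k, exists p,
    `|w| <= rho * r -> P p /\ `|sigma w - p| <= l.
  move=> w; have [wr|] := boolP (`|w| <= rho * r); last by exists 0.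
  by have [x Px xl] := net _ (sph _ wr); exists x.
pose T w := G 0 - G (p w).
have Tr (w : 'rV[R]_k) : `|w| <= rho * r -> `|T w| <= rho * r.
  move=> /pP[Pw _]; rewrite (le_trans (GP _ _ _ _)); [by []|by right|by left|].
  by rewrite sub0r normrN ler_pM ?(ltW e0)// (sphere_norm_le (Psph _ Pw)).
pose w i := iter i T 0.
have wr i : `|w i| <= rho * r.
  by elim: i => [|i IH]; [rewrite normr0 mulr_ge0 ?ltW|exact: Tr].
(* Both net points lie within [l] of their lifts, and the lifts are [K]-Lipschitz in [w]. *)
have step i : `|w i.+2 - w i.+1| <= 2 * e * l + `|w i.+1 - w i| / 2.
  have [P1 s1] := pP _ (wr i); have [P2 s2] := pP _ (wr i.+1).
  have -> : w i.+2 - w i.+1 = G (p (w i)) - G (p (w i.+1)).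
    by rewrite [w i.+2]/(T _) [X in _ - X]/(T _) /T opprB addrC addrA subrK.
  rewrite (le_trans (GP _ _ _ _)); [by []|by left|by left|].
  have : `|p (w i) - p (w i.+1)| <= l + (K * `|w i.+1 - w i| + l).
    rewrite (le_trans (ler_distD (sigma (w i)) _ _))// lerD//; first by rewrite distrC.
    rewrite (le_trans (ler_distD (sigma (w i.+1)) _ _))// lerD//.
    by rewrite distrC slip.
  move=> /(ler_wpM2l (ltW e0))/le_trans; apply.
  have := ler_wpM2r (normr_ge0 (w i.+1 - w i)) eK.
  lra.
have el0 : 0 < 2 * e * l by rewrite !mulr_gt0.
have [i wi] := halving_recursion (d := fun i => `|w i.+1 - w i|) el0 step.
have [Pi si] := pP _ (wr i).
exists (p (w i)) => //.
(* Since [sigma w *m A = w], the value splits into a net error and the displacement of a nearly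
   stationary iterate. *)
have -> : p (w i) *m A + (G (p (w i)) - G 0) =
    (p (w i) - sigma (w i)) *m A + (w i - w i.+1).
  by rewrite mulmxBl sA [RHS]addrA subrK [w i.+1]/(T _) /T opprB.
rewrite (le_trans (ler_normD _ _))// (distrC (w i)).
rewrite distrC in si.
have := le_trans (Aa (p (w i) - sigma (w i))) (ler_wpM2l (ltW a0) si).
lra.
Qed.

(** * Counting points on spheres *)

(* |x_j^2 - y_j^2| <= sum_(i != j) |x_i - y_i| (|x_j| + |y_j|) because [j]
   dominates, and |x_j| + |y_j| = |x_j + y_j| cancels. *)
Lemma dominant_coord_lipschitz (R : realType) (n : nat) (x y : 'rV[R]_n)
    (h : R) (j : 'I_n) :
  0 <= h -> enorm x = enorm y -> (forall i, `|x 0 i| <= `|x 0 j|) ->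
  (forall i, `|y 0 i| <= `|y 0 j|) -> (0 <= x 0 j) = (0 <= y 0 j) ->
  (forall i, i != j -> `|x 0 i - y 0 i| <= h) -> `|x - y| <= n%:R * h.
Proof.
move=> h0 exy xj yj sxy xyh.
have n1 : 1 <= n%:R :> R by rewrite ler1n (leq_ltn_trans _ (ltn_ord j)).
apply: row_norm_le => [|i]; first by rewrite mulr_ge0.
have [->|ij] := eqVneq i j; last first.
  rewrite !mxE (le_trans (xyh _ ij))// -[leLHS]mul1r ler_wpM2r//.
rewrite !mxE.
have sumxy : `|x 0 j| + `|y 0 j| = `|x 0 j + y 0 j|.
  have [x0|x0] := leP 0 (x 0 j); move: sxy.
    by rewrite x0 => /esym y0; rewrite !ger0_norm// addr_ge0.
  rewrite leNgt x0/= => /esym/negbT; rewrite -ltNge => y0.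
  by rewrite !ltr0_norm ?opprD// -[ltRHS]addr0 ltrD.
have [z0|z0] := eqVneq (`|x 0 j| + `|y 0 j|) 0.
  move: z0 => /eqP; rewrite paddr_eq0// => /andP[/eqP/normr0_eq0-> /eqP/normr0_eq0->].
  by rewrite subrr normr0 mulr_ge0.
have zpos : 0 < `|x 0 j| + `|y 0 j| by rewrite lt_def z0 addr_ge0.
rewrite -(ler_pM2r zpos) [in leLHS]sumxy -normrM -subr_sqr.
have -> : x 0 j ^+ 2 - y 0 j ^+ 2 = \sum_(i | i != j) (y 0 i ^+ 2 - x 0 i ^+ 2).
  have := congr1 (fun z => z ^+ 2) exy.
  rewrite /= !sqr_enorm (bigD1 j)//= [in RHS](bigD1 j)//= sumrB; lra.
rewrite (le_trans (ler_norm_sum _ _ _))//.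
apply: (@le_trans _ _ (\sum_(i | i != j) h * (`|x 0 j| + `|y 0 j|))).
  apply: ler_sum => i' ij; rewrite subr_sqr normrM distrC ler_pM ?xyh//.
  by rewrite addrC (le_trans (ler_normD _ _))// lerD.
rewrite sumr_const -[leLHS]mulr_natl mulrA ler_wpM2r ?(ltW zpos)// ler_wpM2r//.
by rewrite ler_nat (leq_trans (max_card _))// card_ord.
Qed.

Lemma same_truncn (R : realType) (a b h : R) : 0 < h -> 0 <= a -> 0 <= b ->
  Num.truncn (a / h) = Num.truncn (b / h) -> `|a - b| <= h.
Proof.
move=> h0 a0 b0 ab.
have /andP[a1 a2] := truncn_itv (divr_ge0 a0 (ltW h0)).
have /andP[b1 b2] := truncn_itv (divr_ge0 b0 (ltW h0)).
rewrite ab in a1 a2.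
have : `|a / h - b / h| <= 1 by rewrite ler_norml; move: a2 b2; rewrite -natr1; lra.
by rewrite -mulrBl normrM normfV (gtr0_norm h0) ler_pdivrMr// mul1r.
Qed.

(** A cell records which coordinate dominates ([n] choices), its sign (2 choices), and the grid
    interval of length [h] of each of the other [k] coordinates in [J]. The dominant coordinate is
    then controlled by [dominant_coord_lipschitz], so the exponent is [k] and not k + 1. *)
Lemma sphere_cells (R : realType) (n k : nat) (J : {set 'I_n}) (r h : R) :
  #|J| = k.+1 -> 0 < r -> 0 < h ->
  exists c : 'rV[R]_n -> 'I_(n * 2 * (Num.truncn (2 * r / h)%R).+1 ^ k),
    forall x y, sphere J r x -> sphere J r y -> c x = c y -> `|x - y| <= n%:R * h.
Proof.
move=> cJ r0 h0; set M := Num.truncn _.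
have [i0 i0J] : exists i, i \in J by apply/set0Pn; rewrite -card_gt0 cJ.
pose top (x : 'rV[R]_n) := [arg max_(i > i0) `|x 0 i|]%O.
have topP (x : 'rV[R]_n) i : `|x 0 i| <= `|x 0 (top x)|.
  by rewrite /top; case: Order.TotalTheory.arg_maxP => // j _; exact.
have topJ (x : 'rV[R]_n) : sphere J r x -> top x \in J.
  move=> [xr xJ]; apply/negPn/negP => /xJ x0.
  have : `|x| <= 0 by apply: row_norm_le => // i; rewrite (le_trans (topP x i))// x0 normr0.
  rewrite normr_le0 => /eqP x00; move: r0.
  by rewrite -xr x00 enorm0 ltxx.
pose rest j (i : 'I_k) := nth j (enum (J :\ j)%SET) i.
have restP j i : j \in J -> i \in J -> i != j -> exists i', rest j i' = i.
  move=> jJ iJ ij.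
  have iE : i \in enum (J :\ j)%SET by rewrite mem_enum in_setD1 ij.
  have ik : (index i (enum (J :\ j)%SET) < k)%N.
    by move: iE; rewrite -index_mem -cardE cardsDS ?finset.sub1set// cards1 cJ subn1.
  by exists (Ordinal ik); rewrite /rest nth_index.
(* On the sphere the shifted coordinates lie in [0, 2r], so [inord] never falls back to its default
   there. *)
pose code (x : 'rV[R]_n) : 'I_n * bool * {ffun 'I_k -> 'I_M.+1} :=
  (top x, 0 <= x 0 (top x),
   [ffun i => inord (Num.truncn ((x 0 (rest (top x) i) + r) / h))]).
have cT : #|{: 'I_n * bool * {ffun 'I_k -> 'I_M.+1}}| = (n * 2 * M.+1 ^ k)%N.
  by rewrite !card_prod card_ffun !card_ord card_bool.
exists (fun x => cast_ord cT (enum_rank (code x))) => x y xS yS.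
move=> /cast_ord_inj/enum_rank_inj[txy sxy /ffunP fxy].
have coordr (z : 'rV[R]_n) i : sphere J r z -> 0 <= z 0 i + r <= 2 * r.
  move=> /sphere_norm_le/(le_trans (coord_le_norm z i)).
  by rewrite ler_norml; lra.
have trM (z : 'rV[R]_n) (i : 'I_n) : sphere J r z ->
    (Num.truncn ((z 0 i + r) / h)%R < M.+1)%N.
  move=> /(coordr _ i)/andP[_ zr]; rewrite ltnS le_truncn// ler_wpM2r//.
  by rewrite invr_ge0 ltW.
apply: (@dominant_coord_lipschitz _ _ _ _ _ (top x)).
- exact: ltW.
- by rewrite xS.1 yS.1.
- exact: topP.
- by rewrite txy; exact: topP.
- by rewrite sxy txy.
- move=> i itx; have [iJ|iJ] := boolP (i \in J); last first.
    by rewrite xS.2// yS.2// subrr normr0 ltW.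
  have [i' i'E] := restP _ _ (topJ _ xS) iJ itx.
  have := fxy i'; rewrite !ffunE -txy i'E => /(congr1 val)/=.
  rewrite !inordK ?trM// => /(same_truncn h0).
  rewrite (_ : x 0 i + r - (y 0 i + r) = x 0 i - y 0 i); last by ring.
  by apply; [have /andP[]:= coordr x i xS|have /andP[]:= coordr y i yS].
Qed.

Lemma enormB_C (R : realType) (n : nat) (x y : 'rV[R]_n) : enorm (x - y) = enorm (y - x).
Proof. by congr Num.sqrt; apply: eq_bigr => i _; rewrite !mxE -sqrrN opprB. Qed.

Lemma inj_ord_card_le (T : Type) (A : set T) (m : nat) (f : T -> 'I_m) :
  {in A &, injective f} -> (A #<= `I_m)%card.
Proof.
move=> finj; have ginj : {in A &, injective (fun x => val (f x))}.
  by move=> x y Ax Ay /val_inj; exact: finj.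
have /card_eqPle[_ /card_le_trans] := inj_card_eq ginj; apply.
by apply: subset_card_le => _ [x _ <-] /=.
Qed.

(* From [sphere_cells] with [h = d / (2 n^2)]: [2 r / h + 1] is at most
   [(4 n^2 + 1) r / d] when [d <= r]. *)
Definition cell_const (R : realType) (n k : nat) : R :=
  n%:R * 2 * (4 * n%:R ^+ 2 + 1) ^+ k.

Lemma cell_const_ge0 (R : realType) (n k : nat) : 0 <= cell_const R n k.
Proof.
have h : 0 <= 4 * n%:R ^+ 2 + 1 :> R by rewrite addr_ge0// mulr_ge0// sqr_ge0.
by rewrite /cell_const mulr_ge0 ?exprn_ge0// mulr_ge0.
Qed.

Section layer.
Variables (R : realType) (n k : nat) (J : {set 'I_n}) (r : R).
Hypotheses (cJ : #|J| = k.+1) (r0 : 0 < r).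

Let n0 : (0 < n)%N.
Proof. by have := max_card (mem J); rewrite cJ card_ord; exact: leq_trans. Qed.

Lemma sphere_small_cells (d : R) : 0 < d <= r ->
  exists2 K : nat, K%:R <= cell_const R n k * (r / d) ^+ k &
  exists c : 'rV[R]_n -> 'I_K,
    forall x y, sphere J r x -> sphere J r y -> c x = c y -> enorm (x - y) < d.
Proof.
move=> /andP[d0 dr].
have nR : 0 < n%:R :> R by rewrite ltr0n.
(* One factor [n] comes from [sphere_cells], one from passing to [enorm]; the 2 makes the final
   inequality strict. *)
pose h := d / (2 * n%:R ^+ 2).
have h0 : 0 < h by rewrite divr_gt0// mulr_gt0// exprn_gt0.
have [c cP] := sphere_cells cJ r0 h0.
exists (n * 2 * (Num.truncn (2 * r / h)%R).+1 ^ k)%N.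
  rewrite !natrM natrX /cell_const -[leRHS]mulrA ler_wpM2l// -exprMn.
  rewrite lerXn2r ?nnegrE//.
    by rewrite mulr_ge0 ?addr_ge0 ?mulr_ge0 ?sqr_ge0 ?invr_ge0// ltW.
  have q1 : 1 <= r / d by rewrite ler_pdivlMr// mul1r.
  rewrite [leRHS]mulrDl mul1r -natr1 lerD//.
  have -> : 4 * n%:R ^+ 2 * (r / d) = 2 * r / h.
    by rewrite /h; field; rewrite !gt_eqF.
  by rewrite truncn_le divr_ge0 ?ltW// mulr_gt0.
exists c => x y xS yS /(cP _ _ xS yS) xy.
rewrite (le_lt_trans (enorm_le_norm _))// (le_lt_trans (ler_wpM2l (ltW nR) xy))//.
have -> : n%:R * (n%:R * h) = d / 2 by rewrite /h; field; rewrite gt_eqF.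
lra.
Qed.

(** A cell of diameter below [l] contains at most one point of [P]. *)
Lemma separated_finite (l : R) (P : set 'rV[R]_n) : 0 < l <= r ->
  separated_in l (sphere J r) P -> finite_set P.
Proof.
move=> lr [PS Psep].
have [K _ [c cP]] := sphere_small_cells lr.
have cinj : {in P &, injective c}.
  move=> x y /set_mem Px /set_mem Py cxy; apply/eqP; apply: contraT => xy.
  have := Psep _ _ Px Py xy; rewrite leNgt cP//; exact: PS.
by apply/finite_set_leP; exists K; exact: inj_ord_card_le cinj.
Qed.

(** A point at distance at least [l] from all of [P] could be added to [P]. By finiteness this would
    strictly increase the cardinality. *)
Lemma maximal_net (l : R) (P : set 'rV[R]_n) : 0 < l <= r ->
  max_card_separated_in l (sphere J r) P ->
  forall x, sphere J r x -> exists2 p, P p & enorm (x - p) < l.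
Proof.
move=> lr [Psep Pmax] x xS; apply: contrapT => /forall2NP xP.
have finP := separated_finite lr Psep.
have xl p : P p -> l <= enorm (x - p).
  by move=> Pp; rewrite leNgt; apply/negP; case: (xP p).
have xNP : ~ P x.
  move=> /xl; rewrite subrr enorm0 leNgt; by case/andP: lr => ->.
have Bsep : separated_in l (sphere J r) (x |` P).
  split=> [y [->//|/Psep.1]//|y z].
  move=> [->|Py] [->|Pz]; rewrite ?eqxx//; first by move=> _; exact: xl.
    by rewrite enormB_C => _; exact: xl.
  exact: Psep.2.
have finB : finite_set (x |` P) by rewrite finite_setU; split.
have /(fcard_eq finB finP) : (x |` P #= P)%card.
  by apply/card_eqPle; split; [exact: Pmax|apply: subset_card_le => y; right].
have xnP : x \notin P by apply/negP => /set_mem.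
rewrite fset_setU1// finmap.cardfsU1 in_fset_set// xnP add1n => /eqP.
by rewrite -[eqbRHS]add0n -add1n eqn_add2r.
Qed.

(** Cells are taken at scale max(l, d), with a point of [P] as center in each occupied one. Two
    points of [P] in one cell are either closer than [l], hence equal, or closer than [d]. *)
Lemma layer_cover (l d : R) (P : set 'rV[R]_n) : 0 < l <= r -> 0 < d ->
  d <= r -> separated_in l (sphere J r) P ->
  exists2 K : nat, K%:R <= cell_const R n k * (r / Num.max l d) ^+ k &
  exists c : 'I_K -> 'rV[R]_n,
    P `<=` \bigcup_i [set x | enorm (x - c i) <= d].
Proof.
move=> /andP[l0 lr] d0 dr [PS Psep].
have mr : 0 < Num.max l d <= r by rewrite lt_max l0 ge_max lr.
have [K KC [c cP]] := sphere_small_cells mr; exists K => //.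
have /choice[p pP] : forall i : 'I_K, exists p,
    (exists2 x, P x & c x = i) -> P p /\ c p = i.
  move=> i; have [[x Px cx]|] := pselect (exists2 x, P x & c x = i); first by exists x.
  by exists 0.
exists p => x Px; exists (c x) => //=.
have [Pp cp] := pP (c x) (ex_intro2 _ _ x Px erefl).
have := cP _ _ (PS _ Px) (PS _ Pp) (esym cp); rewrite lt_max => /orP[xl|/ltW//].
have [<-|xp] := eqVneq x (p (c x)); first by rewrite subrr enorm0 ltW.
by have := Psep _ _ Px Pp xp; rewrite leNgt xl.
Qed.

(** A grid of mesh [l] in [k] of the coordinates of [J] is lifted to the sphere through the
    remaining coordinate [j0]. This bounds the maximal cardinality of a separated set from below. *)
Lemma separated_grid (l : R) : 0 < l <= r ->
  exists (M : nat) (F : {ffun 'I_n -> 'I_M.+1} -> 'rV[R]_n)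
     (D : {set {ffun 'I_n -> 'I_M.+1}}),
  [/\ (r / (n%:R * l)) ^+ k <= #|D|%:R, {in D &, injective F} &
      separated_in l (sphere J r) (F @` [set` D])].
Proof.
move=> /andP[l0 lr].
have nR : 0 < n%:R :> R by rewrite ltr0n.
have [j0 j0J] : exists i, i \in J by apply/set0Pn; rewrite -card_gt0 cJ.
(* Each grid coordinate is at most r / n, so the sum of their squares is at most r^2 and the lift
   exists. *)
pose M := Num.truncn (r / (n%:R * l))%R.
pose s (f : {ffun 'I_n -> 'I_M.+1}) : R := \sum_i (l * (f i)%:R) ^+ 2.
pose F (f : {ffun 'I_n -> 'I_M.+1}) : 'rV[R]_n :=
  \row_j if j == j0 then Num.sqrt (r ^+ 2 - s f) else l * (f j)%:R.
(* Index functions vanishing off [J] minus [j0]: there are (M + 1)^k of them. *)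
pose D : {set {ffun 'I_n -> 'I_M.+1}} :=
  finset (fun f => f \in pffun_on (ord0 : 'I_M.+1) (mem (J :\ j0)%SET) predT).
have D0 f j : f \in D -> j \notin (J :\ j0)%SET -> f j = ord0.
  rewrite finset.in_set => /pffun_onP[+ _] => /fintype.subsetP/(_ j) fD jJ.
  by apply/eqP; apply: contraNT jJ => /fD.
have sr f : s f <= r ^+ 2.
  apply: (@le_trans _ _ (\sum_(i < n) (r / n%:R) ^+ 2)).
    apply: ler_sum => i _; rewrite lerXn2r ?nnegrE ?mulr_ge0 ?divr_ge0 ?(ltW r0) ?(ltW l0)//.
    have : (f i)%:R <= r / (n%:R * l).
      apply: (@le_trans _ _ M%:R); first by rewrite ler_nat -ltnS ltn_ord.
      by rewrite truncn_le divr_ge0 ?mulr_ge0 ?(ltW r0) ?(ltW l0).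
    by rewrite invfM mulrA ler_pdivlMr// mulrC.
  rewrite sumr_const card_ord -[leLHS]mulr_natl exprMn mulrCA ler_piMr ?sqr_ge0//.
  by rewrite exprVn expr2 invfM mulrA mulfV ?gt_eqF// mul1r invf_le1// ler1n.
have Fsep f g : f \in D -> g \in D -> f != g -> l <= enorm (F f - F g).
  move=> fD gD fg.
  have [j fgj] : exists j, f j != g j.
    apply/existsP; apply: contraNT fg => /existsPn h; apply/eqP/ffunP => j.
    exact/eqP/negPn/h.
  have jJ : j \in (J :\ j0)%SET.
    by apply: contraNT fgj => jJ; rewrite !D0.
  rewrite (le_trans _ (norm_le_enorm _))// (le_trans _ (coord_le_norm _ j))//.
  move: jJ; rewrite in_setD1 => /andP[/negPf jj0 _].
  rewrite !mxE jj0 -mulrBr normrM gtr0_norm// ler_peMr ?(ltW l0)//.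
  move: fgj; rewrite -val_eqE neq_ltn -!(ler_nat R) -!natr1 ler_normr.
  by move=> /orP[] ?; apply/orP; [right|left]; lra.
exists M, F, D; split.
- rewrite cardsE card_pffun_on cardsDS ?finset.sub1set// cards1 cJ subn1/= card_ord natrX.
  rewrite lerXn2r ?nnegrE ?divr_ge0 ?mulr_ge0 ?(ltW r0) ?(ltW l0)//.
  by rewrite ltW// truncnS_gt.
- move=> f g fD gD Ffg; apply/eqP; apply: contraT => fg.
  by have := Fsep _ _ fD gD fg; rewrite Ffg subrr enorm0 leNgt l0.
- split=> [_ [f fD <-]|_ _ [f fD <-] [g gD <-] fg]; last first.
    by apply: Fsep => //; apply: contraNneq fg => ->.
  split=> [|j jJ]; last first.
    have jj0 : j != j0 by apply: contraNneq jJ => ->.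
    by rewrite mxE (negPf jj0) D0// ?mulr0// in_setD1 (negPf jJ) andbF.
  rewrite /enorm (bigD1 j0)//= mxE eqxx sqr_sqrtr ?subr_ge0//.
  rewrite (_ : \sum_(i | _) _ = s f); first by rewrite subrK sqrtr_sqr gtr0_norm.
  rewrite /s [RHS](bigD1 j0)//= D0// ?in_setD1 ?eqxx// mulr0 expr0n add0r.
  by apply: eq_bigr => j /negPf jj0; rewrite mxE jj0.
Qed.

(** A ball of radius [d] holds at most one point of [P], so [m] is at least the cardinality of [P],
    which by maximality is at least that of the grid. *)
Lemma maximal_cover_card (l d : R) (P : set 'rV[R]_n) (m : nat)
    (c : 'I_m -> 'rV[R]_n) : 0 < l <= r ->
  2 * n%:R * d < l ->
  max_card_separated_in l (sphere J r) P ->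
  P `<=` \bigcup_i [set x | enorm (x - c i) <= d] ->
  (r / (n%:R * l)) ^+ k <= m%:R.
Proof.
move=> lr dl [[PS Psep] Pmax] cov.
have [M [F [D [Dge Finj Fsep]]]] := separated_grid lr.
rewrite (le_trans Dge)// ler_nat.
(* A point of [P] provides an index in ['I_m], the default value of [b] outside [P]. *)
have P0 : P !=set0.
  apply/set0P/eqP => P0; have := Pmax _ Fsep; rewrite P0 card_le0 => /eqP FD0.
  suff D0 : #|D| = 0%N.
    move: Dge; rewrite D0 leNgt exprn_gt0// divr_gt0// mulr_gt0 ?ltr0n//.
    by case/andP: lr.
  apply/eqP; rewrite finset.cards_eq0; apply/eqP/finset.setP => f.
  rewrite finset.in_set0; apply/negP => fD.
  by have : (F @` [set` D]) (F f) by [exists f]; rewrite FD0.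
have /choice[b bP] : forall x, exists i, P x -> enorm (x - c i) <= d.
  have [x0 /cov[i _ _]] := P0.
  move=> x; have [/cov[i' _ xi]|] := pselect (P x); first by exists i'.
  by exists i.
have binj : {in P &, injective b}.
  move=> x y /set_mem Px /set_mem Py bxy; apply/eqP; apply: contraT => xy.
  have := Psep _ _ Px Py xy; rewrite leNgt (le_lt_trans _ dl)//.
  rewrite (le_trans (enorm_le_norm _))// [leRHS]mulrAC [leRHS]mulrC ler_wpM2l//.
  rewrite (le_trans (ler_distD (c (b x)) _ _))// mulrDl mul1r lerD//.
    by rewrite (le_trans (norm_le_enorm _))// bP.
  by rewrite distrC bxy (le_trans (norm_le_enorm _))// bP.
have DP : ([set` D] #<= `I_m)%card.
  apply: card_le_trans (inj_ord_card_le binj).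
  apply: card_le_trans (Pmax _ Fsep).
  have FI : {in [set` D] &, injective F}.
    by move=> f g /set_mem fD /set_mem gD; exact: Finj.
  by have /card_eqPle[] := inj_card_eq FI.
rewrite (leq_trans _ (geq_card_fset_set DP))// cardE.
rewrite uniq_leq_size ?enum_uniq// => f; rewrite mem_enum => fD.
rewrite in_fset_set; first exact: mem_set.
exact: finite_finset.
Qed.

End layer.

(** * Hausdorff and box dimensions *)

Section dimension_lemmas.
Variables (R : realType) (n : nat).
Implicit Types (E : set 'rV[R]_n) (s : R).

Lemma diam_pow_subsingleton s E : 0 < s ->
  (forall x y, E x -> E y -> x = y) -> diam_pow s E = 0%E.
Proof.
move=> s0 E1; rewrite /diam_pow; case: eqP => // /eqP/set0P[x Ex].
rewrite (_ : diam E = 0%E) ?poweR0r ?gt_eqF//.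
rewrite /diam (_ : [set _ | _ in _ & _ in _] = [set 0%E]) ?ereal_sup1//.
apply/seteqP; split=> [_ [y Ey [z Ez <-]]|_ ->].
  by rewrite (E1 _ _ Ey Ez) subrr enorm0.
by exists x => //; exists x => //; rewrite subrr enorm0.
Qed.

Lemma diam_subsingleton_le E (d : R) : 0 < d ->
  (forall x y, E x -> E y -> x = y) -> (diam E <= d%:E)%E.
Proof.
move=> d0 E1; apply: ge_ereal_sup => _ [y Ey [z Ez <-]].
by rewrite (E1 _ _ Ey Ez) subrr enorm0 lee_fin ltW.
Qed.

Lemma diam_pow_ge0 s E : (0 <= diam_pow s E)%E.
Proof. by rewrite /diam_pow; case: ifP => // _; exact: poweR_ge0. Qed.

(** The fibres of an injection into the naturals cover [E] by sets with at most one point, which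
    contribute 0 because [s > 0]. *)
Lemma hausdorff_premeasure_countable s d E : 0 < s -> 0 < d -> countable E ->
  hausdorff_premeasure s d E = 0%E.
Proof.
move=> s0 d0 /countable_injP[f finj]; apply/eqP.
rewrite eq_le; apply/andP; split; last first.
  apply: le_ereal_inf_tmp => _ [V _ <-]; apply: nneseries_ge0 => i _ _.
  exact: diam_pow_ge0.
apply: ereal_inf_lbound; exists (fun i => E `&` f @^-1` [set i]); last first.
  apply: eseries0 => i _ _; apply: diam_pow_subsingleton => // x y [Ex fx] [Ey fy].
  by apply: finj; rewrite ?inE// fx fy.
split=> [x Ex|i]; first by exists (f x).
apply: diam_subsingleton_le => // x y [Ex fx] [Ey fy].
by apply: finj; rewrite ?inE// fx fy.
Qed.

Lemma hausdorff_dim_countable E : countable E -> hausdorff_dim E = 0%E.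
Proof.
move=> cE; apply/eqP; rewrite eq_le; apply/andP; split; last first.
  by apply: le_ereal_inf_tmp => _ [s [s0 _] <-]; rewrite lee_fin.
apply/lee_addgt0Pr => e e0; rewrite add0e; apply: ereal_inf_lbound.
exists e => //; split; first exact: ltW.
rewrite /hausdorff_measure (_ : [set _ | _ in _] = [set 0%E]) ?ereal_sup1//.
apply/seteqP; split=> [_ [d /= d0 <-]|_ ->].
  by rewrite hausdorff_premeasure_countable.
by exists 1 => //=; rewrite hausdorff_premeasure_countable.
Qed.

Lemma covering_number_le E (d : R) (cs : seq 'rV[R]_n) :
  (forall x, E x -> exists2 c, c \in cs & enorm (x - c) <= d) ->
  (covering_number E d <= (size cs)%:R%:E)%E.
Proof.
move=> cov; apply: ereal_inf_lbound; exists (size cs) => //=.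
exists (fun i => cs`_i) => x /cov[c ccs xc].
have ic : (index c cs < size cs)%N by rewrite index_mem.
by exists (Ordinal ic) => //=; rewrite nth_index.
Qed.

Lemma covering_number_ge0 E (d : R) : (0 <= covering_number E d)%E.
Proof. by apply: le_ereal_inf_tmp => _ [m _ <-]; rewrite lee_fin. Qed.

Lemma near0_lnN (M : R) : \forall d \near (0 : R)^'+, 0 < d /\ M < - ln d.
Proof.
near=> d.
have d0 : 0 < d by near: d; exact: nbhs_right_gt.
split=> //; rewrite ltrNr -(expRK (- M)) ltr_ln ?posrE ?expR_gt0//.
by near: d; apply: nbhs_right_lt; exact: expR_gt0.
Unshelve. all: by end_near. Qed.

Lemma lower_le_upper_box_dim E : (lower_box_dim E <= upper_box_dim E)%E.
Proof.
rewrite /lower_box_dim limf_einfE; apply: ge_ereal_sup => _ [V nV <-].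
apply: le_ereal_inf_tmp => _ [W nW <-].
have [d [Vd Wd]] : (V `&` W) !=set0.
  by apply: (@filter_ex _ (0 : R)^'+); exact: filterI.
apply: (@le_trans _ _ (box_ratio E d)).
  by apply: ereal_inf_lbound; exists d.
by apply: ereal_sup_ubound; exists d.
Qed.

(** The slack [e] leaves room for a factor logarithmic in 1/d in the covering number; [C] disappears
    after division by [- ln d]. *)
Lemma upper_box_dim_le E s :
  (forall e, 0 < e -> exists C : R, \forall d \near (0 : R)^'+,
    (lne (covering_number E d) <= ((s + e) * - ln d + C)%:E)%E) ->
  (upper_box_dim E <= s%:E)%E.
Proof.
move=> cov; apply/lee_addgt0Pr => e e0.
have e20 : 0 < e / 2 by rewrite divr_gt0.
have [C nC] := cov _ e20.
apply: le_trans; first apply: ereal_inf_lbound.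
  exists [set d | (0 < d /\ `|C / (e / 2)| < - ln d) /\
    (lne (covering_number E d) <= ((s + e / 2) * - ln d + C)%:E)%E] => //.
  by apply: filterI => //; exact: near0_lnN.
apply: ge_ereal_sup => _ [d [[d0 dM] dC] <-].
have y0 : 0 < - ln d by rewrite (le_lt_trans _ dM).
rewrite /box_ratio -EFinD; apply: le_trans; first apply: lee_wpmul2r dC.
  by rewrite lee_fin invr_ge0 ltW.
rewrite -EFinM lee_fin ler_pdivrMr//.
have : C <= e / 2 * - ln d.
  by rewrite mulrC -ler_pdivrMr// (le_trans (ler_norm _))// ltW.
by set y := - ln d; lra.
Qed.

Lemma lower_box_dim_ge E s :
  (exists C : R, \forall d \near (0 : R)^'+,
    ((s * - ln d - C)%:E <= lne (covering_number E d))%E) ->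
  (s%:E <= lower_box_dim E)%E.
Proof.
move=> [C nC]; apply/lee_subgt0Pr => e e0; rewrite /lower_box_dim limf_einfE.
apply: le_trans; last apply: ereal_sup_ubound.
  2: exists [set d | (0 < d /\ `|C / e| < - ln d) /\
    ((s * - ln d - C)%:E <= lne (covering_number E d))%E] => //; last first.
  2: by apply: filterI => //; exact: near0_lnN.
apply: le_ereal_inf_tmp => _ [d [[d0 dM] dC] <-].
have y0 : 0 < - ln d by rewrite (le_lt_trans _ dM).
rewrite /box_ratio -EFinB; apply: le_trans; last apply: lee_wpmul2r dC.
  rewrite -EFinM lee_fin ler_pdivlMr//.
  have : C <= e * - ln d.
    by rewrite mulrC -ler_pdivrMr// (le_trans (ler_norm _))// ltW.
  by set y := - ln d; lra.
by rewrite lee_fin invr_ge0 ltW.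
Qed.

End dimension_lemmas.

(** * Countability and box dimensions of the layered set *)

Lemma size_flatten_map_le (R : realType) (T T' : Type) (f : T -> seq T')
    (s : seq T) (B : R) :
  (forall x, (size (f x))%:R <= B) ->
  (size (flatten (map f s)))%:R <= (size s)%:R * B.
Proof.
move=> fB; elim: s => [|x s IH] /=; first by rewrite mul0r.
by rewrite size_cat natrD -natr1 mulrDl mul1r addrC lerD.
Qed.

Lemma layered_setP (R : realType) (k N : nat) (r l : nat -> R) (X : set 'rV[R]_N) :
  (k < N)%N -> admissible_sequences r l -> layered_set k r l X ->
  exists P : {set 'I_N} -> nat -> set 'rV[R]_N,
  [/\ forall (J : {set 'I_N}) i, #|J| = k.+1 -> (1 <= i)%N ->
        max_card_separated_in (l i) (sphere J (r i)) (P J i),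
      forall (J : {set 'I_N}) i x, #|J| = k.+1 -> (1 <= i)%N -> P J i x -> X x,
      X 0,
      forall x, X x -> x = 0 \/ exists (J : {set 'I_N}) i,
        [/\ #|J| = k.+1, (1 <= i)%N & P J i x] &
      exists J : {set 'I_N}, #|J| = k.+1].
Proof.
move=> kN [lr _ _ _] [P [Pmax ->]].
have [J0 cJ0] : exists J : {set 'I_N}, #|J| = k.+1.
  exists (widen_ord kN @: predT)%SET; rewrite card_imset ?card_ord//.
  by move=> i j /(congr1 val)/= /val_inj.
exists P; split; last by exists J0.
- move=> J i cJ i1; rewrite -scaled_coord_sphere; first exact: Pmax.
  by have /andP[l0 lri] := lr i i1; exact: lt_le_trans lri.
- by move=> J i x cJ i1 Px; exists J => //; left; exists i.
- by exists J0 => //; right.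
- move=> x [J cJ [[i i1 Px]|->]]; last by left.
  by right; exists J, i.
Qed.

Lemma expR_lnX (R : realType) (x : R) (m : nat) : 0 < x -> x ^+ m = expR (m%:R * ln x).
Proof. by move=> x0; rewrite expRM_natl lnK. Qed.

Lemma le_lne_EFin (R : realType) (x : \bar R) (y : R) :
  (0 <= x)%E -> 0 < y -> (x <= y%:E)%E ->
  (lne x <= (ln y)%:E)%E.
Proof.
move=> x0 y0 xy; rewrite -lne_EFin// lee_lne// in_itv/= ?leey ?andbT//.
by rewrite lee_fin ltW.
Qed.

Lemma ge_lne_EFin (R : realType) (x : \bar R) (y : R) :
  ((expR y)%:E <= x)%E -> (y%:E <= lne x)%E.
Proof.
move=> yx; rewrite -[y]expRK -lne_EFin ?expR_gt0// lee_lne// in_itv/= ?leey ?andbT.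
  by rewrite lee_fin expR_ge0.
by rewrite (le_trans _ yx)// lee_fin expR_ge0.
Qed.

Section box_dimension.
Variables (R : realType) (k N : nat) (r l : nat -> R) (X : set 'rV[R]_N).
Variable P : {set 'I_N} -> nat -> set 'rV[R]_N.
Hypotheses (lr : forall i, (1 <= i)%N -> 0 < l i <= r i)
  (Pmax : forall (J : {set 'I_N}) i, #|J| = k.+1 -> (1 <= i)%N ->
        max_card_separated_in (l i) (sphere J (r i)) (P J i))
  (XP : forall x, X x -> x = 0 \/ exists (J : {set 'I_N}) i,
        [/\ #|J| = k.+1, (1 <= i)%N & P J i x])
  (PX : forall (J : {set 'I_N}) i x, #|J| = k.+1 -> (1 <= i)%N -> P J i x -> X x).

Lemma layered_countable : countable X.
Proof.
have P_finite (J : {set 'I_N}) i : #|J| = k.+1 -> (1 <= i)%N -> finite_set (P J i).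
  move=> cJ i1; have /andP[l0 lri] := lr i1.
  by apply: (separated_finite cJ _ (lr i1) (Pmax cJ i1).1); exact: lt_le_trans lri.
(* [None] indexes the origin; pairs outside the range of the construction give the empty set. *)
pose Q (o : option ({set 'I_N} * nat)) : set 'rV[R]_N :=
  if o is Some (J, i) then [set x | [/\ #|J| = k.+1, (1 <= i)%N & P J i x]]
  else [set 0].
apply: (@sub_countable _ _ _ (\bigcup_(o in setT) Q o)).
  apply: subset_card_le => x /XP[->|[J [i [cJ i1 Px]]]]; first by exists None.
  by exists (Some (J, i)).
apply: bigcup_countable => [|[[J i]|] _]; [exact: countableP| |exact: countable1].
have [cJ|cJ] := eqVneq #|J| k.+1; last first.
  by rewrite (_ : Q _ = set0)//; apply/seteqP; split=> // x [/eqP/=]; rewrite (negPf cJ).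
have [i1|i1] := leqP 1 i; last first.
  by rewrite (_ : Q _ = set0)//; apply/seteqP; split=> // x [_]/=; rewrite leqNgt i1.
apply: finite_set_countable; apply: sub_finite_set (P_finite J i cJ i1).
by move=> x [].
Qed.

(** One ball at the origin swallows all layers beyond [m]. At most 2^N m pairs (J, i) remain, each
    needing at most [B] balls. *)
Lemma layered_cover (d B : R) (m : nat) : 0 < d -> 0 <= B ->
  (forall i, (m < i)%N -> r i <= d) ->
  (forall i, (1 <= i)%N -> d <= r i ->
     cell_const R N k * (r i / Num.max (l i) d) ^+ k <= B) ->
  (covering_number X d <= (1 + 2 ^+ N * m%:R * B)%:E)%E.
Proof.
move=> d0 B0 rm rB.
have /choice[S SP] : forall Ji : {set 'I_N} * nat, exists cs : seq 'rV[R]_N,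
    (size cs)%:R <= B /\ (#|Ji.1| = k.+1 -> (1 <= Ji.2)%N -> forall x, P Ji.1 Ji.2 x ->
      d <= r Ji.2 -> exists2 c, c \in cs & enorm (x - c) <= d).
  move=> [J i] /=.
  have [[cJ i1 dr]|] := pselect [/\ #|J| = k.+1, (1 <= i)%N & d <= r i]; last first.
    by move=> h; exists [::]; split=> // cJ i1 x _ dr; case: h.
  have r0 : 0 < r i := lt_le_trans d0 dr.
  have [K KC [c cP]] := layer_cover cJ r0 (lr i1) d0 dr (Pmax cJ i1).1.
  exists (codom c); split; first by rewrite size_codom card_ord (le_trans KC)// rB.
  by move=> _ _ x /cP[j _ /= xj] _; exists (c j) => //; exact: codom_f.
pose pairs := [seq (J, i) | J <- enum {set 'I_N}, i <- iota 1 m].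
apply: (@le_trans _ _ (size (0 :: flatten (map S pairs)))%:R%:E); last first.
  rewrite lee_fin /= -natr1 addrC lerD2l.
  apply: le_trans.
    by apply: (@size_flatten_map_le _ _ _ S pairs B) => Ji; case: (SP Ji).
  rewrite size_allpairs size_iota -cardE -cardsT -powersetT card_powerset cardsT card_ord.
  by rewrite natrM natrX.
apply: covering_number_le => x Xx.
have [xd|xd] := leP (enorm x) d.
  by exists 0; rewrite ?mem_head// subr0.
have [x0|[J [i [cJ i1 Px]]]] := XP Xx.
  by move: xd; rewrite x0 enorm0 ltNge (ltW d0).
have xr : enorm x = r i := ((Pmax cJ i1).1.1 _ Px).1.
have im : (i <= m)%N.
  by rewrite leqNgt; apply/negP => /rm; rewrite -xr leNgt xd.
have [_ /(_ cJ i1 x Px)[|c cS xc]] := SP (J, i); first by rewrite /= -xr ltW.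
exists c => //; rewrite in_cons; apply/orP; right; apply/flatten_mapP.
exists (J, i) => //; apply/allpairsP; exists (J, i); split=> //=.
  by rewrite mem_enum.
by rewrite mem_iota i1 add1n ltnS.
Qed.

Variables (s t : R).
Hypotheses (sk : 0 < s < k%:R) (tE : t = k%:R / (k%:R - s)).
Hypothesis rlE : forall i, (1 <= i)%N -> r i = 2 ^- i /\ l i = 2 `^ (- (i%:R * t)).

Let ln2_gt0 : 0 < ln 2 :> R.
Proof. by rewrite ln_gt0// ltr1n. Qed.

Let t_gt0 : 0 < t.
Proof. by have /andP[s0 s1] := sk; rewrite tE divr_gt0 ?subr_gt0// (lt_trans s0). Qed.

Let ln_l i : (1 <= i)%N -> ln (l i) = - (i%:R * t * ln 2).
Proof. by move=> /rlE[_ ->]; rewrite ln_powR mulNr. Qed.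

Let ln_r i : (1 <= i)%N -> ln (r i) = - (i%:R * ln 2).
Proof. by move=> /rlE[-> _]; rewrite lnV ?posrE ?exprn_gt0// lnXn// mulr_natl. Qed.

(** Since t (k - s) = k, the layers satisfy r_i^k = l_i^(k - s). Both box-dimension bounds rest on
    this identity. *)
Let k_ln_r i : (1 <= i)%N -> k%:R * ln (r i) = (k%:R - s) * ln (l i).
Proof.
move=> i1; rewrite ln_r// ln_l// tE; field.
by have /andP[_ s1] := sk; rewrite subr_eq0 gt_eqF.
Qed.

Lemma layered_upper_box_dim : (upper_box_dim X <= s%:E)%E.
Proof.
have /andP[s0 s1] := sk.
apply: upper_box_dim_le => e e0.
pose C := 1 + 2 ^+ N / ln 2 * cell_const R N k.
have C0 : 0 < C.
  rewrite ltr_pwDl// mulr_ge0 ?cell_const_ge0//.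
  by rewrite divr_ge0 ?exprn_ge0 ?(ltW ln2_gt0).
exists (ln C - ln e).
apply: filterS (near0_lnN 1) => d [d0].
set y := - ln d => y1.
have y0 : 0 < y by rewrite (lt_trans _ y1).
have dE : ln d = - y by rewrite opprK.
have cov : (covering_number X d <= (C * (y * expR (s * y)))%:E)%E.
  pose B := cell_const R N k * expR (s * y).
  have B0 : 0 <= B by rewrite mulr_ge0 ?expR_ge0 ?cell_const_ge0.
  (* For i > y / ln 2 the radius 2^(-i) is below [d]. *)
  apply: le_trans; first apply: (@layered_cover d B (Num.truncn (y / ln 2)%R)) => //.
  - move=> i; rewrite truncn_lt_nat ?divr_ge0 ?(ltW y0) ?(ltW ln2_gt0)// => yi.
    have i1 : (1 <= i)%N.
      by rewrite -(ltr_nat R) (le_lt_trans _ yi)// divr_ge0 ?(ltW y0) ?(ltW ln2_gt0).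
    have /andP[l0 lri] := lr i1; have r0 : 0 < r i := lt_le_trans l0 lri.
    rewrite -ler_ln ?posrE// ln_r// dE lerN2.
    by rewrite -ler_pdivrMr// ltW.
  - move=> i i1 dr; have /andP[l0 lri] := lr i1.
    rewrite ler_wpM2l ?cell_const_ge0//.
    have m0 : 0 < Num.max (l i) d by rewrite lt_max l0.
    have r0 : 0 < r i := lt_le_trans l0 lri.
    (* With m = max(l_i, d), r_i^k = l_i^(k - s) <= m^(k - s), so (r_i / m)^k <= m^(-s) <=
       d^(-s). *)
    rewrite expR_lnX ?divr_gt0// ler_expR ln_div ?posrE// mulrBr k_ln_r//.
    have lm : ln (l i) <= ln (Num.max (l i) d) by rewrite ler_ln ?posrE// le_max lexx.
    have dm : - y <= ln (Num.max (l i) d) by rewrite -dE ler_ln ?posrE// le_max lexx orbT.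
    have ks : 0 <= k%:R - s by rewrite subr_ge0 ltW.
    have := ler_wpM2l ks lm; have := ler_wpM2l (ltW s0) dm.
    lra.
  rewrite lee_fin /C mulrDl mul1r lerD//.
    rewrite -[leLHS]mulr1 ler_pM// ?(ltW y1)// -expR0 ler_expR.
    by rewrite mulr_ge0 ?ltW.
  rewrite [leRHS](_ : _ = 2 ^+ N * (y / ln 2) * B); last by rewrite /B; ring.
  rewrite ler_wpM2r// ler_wpM2l// ?exprn_ge0// truncn_le.
  by rewrite divr_ge0 ?(ltW y0) ?(ltW ln2_gt0).
apply: le_trans; first apply: le_lne_EFin cov.
- exact: covering_number_ge0.
- by rewrite !mulr_gt0// expR_gt0.
rewrite lee_fin !lnM ?posrE ?mulr_gt0 ?expR_gt0// expRK.
(* The number of layers adds ln y to the logarithm, and ln y < e y - ln e; hence the constant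
   [ln C - ln e]. *)
have : ln (e * y) < e * y by apply: ln_sublinear; rewrite mulr_gt0.
rewrite lnM ?posrE//; lra.
Qed.

(** A single layer suffices: the last one with 4 N d <= l_i. Its points need separate balls, at
    least N^(-k) l_i^(-s) of them, and l_i < 2^t 4 N d. *)
Lemma layered_lower_box_dim : (exists J : {set 'I_N}, #|J| = k.+1) ->
  (s%:E <= lower_box_dim X)%E.
Proof.
move=> [J cJ]; have /andP[s0 s1] := sk.
have NR : 0 < N%:R :> R.
  by rewrite ltr0n; have := max_card (mem J); rewrite cJ card_ord; exact: leq_trans.
apply: lower_box_dim_ge.
(* The first two terms come from the factor 2^t 4 N between [d] and l_i, the third from the factor
   N^(-k) in the point count. *)
exists (s * ln (4 * N%:R) + s * t * ln 2 + k%:R * ln N%:R).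
(* For such small [d] the selected layer has index at least 1. *)
apply: filterS (near0_lnN (ln (4 * N%:R) + t * ln 2)) => d [d0].
set y := - ln d => yM.
pose z := y - ln (4 * N%:R).
have tl : 0 < t * ln 2 by rewrite mulr_gt0.
have z1 : 1 <= z / (t * ln 2) by rewrite ler_pdivlMr// mul1r /z; lra.
pose i := Num.truncn (z / (t * ln 2))%R.
have i1 : (1 <= i)%N by rewrite truncn_gt0.
have /truncn_itv/andP[] : 0 <= z / (t * ln 2) by rewrite (le_trans _ z1).
rewrite -/i ler_pdivlMr// ltr_pdivrMr// -[i.+1%:R]natr1 mulrDl mul1r => iz zi.
have /andP[l0 lri] := lr i1; have r0 : 0 < r i := lt_le_trans l0 lri.
have dl : 2 * N%:R * d < l i.
  apply: (@lt_le_trans _ _ (4 * N%:R * d)).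
    by rewrite ltr_pM2r// ltr_pM2r//; lra.
  rewrite -ler_ln ?posrE ?mulr_gt0// lnM ?posrE ?mulr_gt0// ln_l//.
  by move: iz; rewrite /z /y; lra.
apply: ge_lne_EFin; apply: le_ereal_inf_tmp => _ [m [c cov] <-].
rewrite lee_fin.
apply: le_trans (maximal_cover_card cJ r0 (lr i1) dl (Pmax cJ i1) (c := c) _); last first.
  by move=> x Px; apply: cov; exact: PX Px.
rewrite expR_lnX ?divr_gt0 ?mulr_gt0// ler_expR ln_div ?posrE ?mulr_gt0//.
rewrite [ln (_ * l i)]lnM ?posrE// mulrBr k_ln_r// ln_l//.
have := ltW zi; rewrite -subr_ge0 => /(mulr_ge0 (ltW s0)); rewrite /z.
lra.
Qed.

End box_dimension.

(** * Perturbations of full-rank linear maps *)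

Section perturbations.
Variables (R : realType) (k N : nat) (X : set 'rV[R]_N).
Implicit Types phi : X -> 'rV[R]_k.

(** The nonlinear part of [phi] has Lipschitz constant [c] in the sup norm, as in
    [forces_almost_zero]. The strict [c < e] leaves the room that makes the condition open. *)
Definition near_full_rank phi : Prop :=
  exists (A : 'M[R]_(N, k)) (J : {set 'I_N}) (e C c : R),
  [/\ #|J| = k.+1, 0 < C, forces_almost_zero A J e C, c < e &
    forall x y : X, `|(phi x - val x *m A) - (phi y - val y *m A)|
      <= c * `|val x - val y|].

Definition lip_near_full_rank : set (X -> 'rV[R]_k) :=
  [set phi | lip_space phi /\ near_full_rank phi].

Lemma lip_near_full_rank_linear (L : {linear 'rV[R]_N -> 'rV[R]_k}) :
  (k < N)%N -> \rank (lin1_mx L) = k ->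
  lip_near_full_rank (fun x : X => L (val x)).
Proof.
move=> kN rkL; split.
  have [a a0 La] := norm_mulmx_le (lin1_mx L).
  exists (k%:R * a) => x y; rewrite -linearB -(mul_rV_lin1 L).
  rewrite (le_trans (enorm_le_norm _))// -mulrA ler_wpM2l//.
  by rewrite (le_trans (La _))// ler_wpM2l ?(ltW a0)// norm_le_enorm.
have [J [e [C [cJ e0 C0 eC]]]] := exists_forces_almost_zero kN rkL.
exists (lin1_mx L), J, e, C, 0; split=> // x y.
by rewrite !mul_rV_lin1 !subrr normr0 mul0r.
Qed.

Lemma lip_norm_lt (h : X -> 'rV[R]_k) (x0 : X) (e : R) :
  (lip_norm h < e%:E)%E ->
  forall x y : X, enorm (h x - h y) <= e * enorm (val x - val y).
Proof.
move=> he x y.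
have hc : (lip_const h <= e%:E)%E.
  (* The point [x0] makes the supremum norm nonnegative; over an empty domain it would be -oo. *)
  apply: le_trans (ltW he); apply: leeDr.
  by apply: le_ereal_sup_tmp; exists (enorm (h x0))%:E; [exists x0|rewrite lee_fin enorm_ge0].
have [xy|xy] := eqVneq (val x) (val y).
  by rewrite (val_inj xy) !subrr !enorm0 mulr0.
have xy0 : 0 < enorm (val x - val y).
  by rewrite (lt_le_trans _ (norm_le_enorm _))// normr_gt0 subr_eq0.
rewrite -ler_pdivrMr// -lee_fin (le_trans _ hc)//.
by apply: ereal_sup_ubound; exists x => //; exists y.
Qed.

Lemma lip_open_near_full_rank : (0 < N)%N -> X 0 -> lip_open lip_near_full_rank.
Proof.
move=> N0 X0; have NR : 0 < N%:R :> R by rewrite ltr0n.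
split=> [phi []//|h [_ [A [J [e [C [c [cJ C0 eC ce hc]]]]]]]].
have ec : 0 < e - c by rewrite subr_gt0.
(* Half of the gap [e - c] is spent, divided by [N] for the passage from [enorm] to the sup norm. *)
exists ((e - c) / (2 * N%:R)); first by rewrite divr_gt0// mulr_gt0.
move=> g lipg gh; split=> //.
exists A, J, e, C, ((c + e) / 2); split=> //; first by lra.
move=> x y.
have -> : g x - val x *m A - (g y - val y *m A) =
    (h x - val x *m A - (h y - val y *m A)) + ((g \- h)%R x - (g \- h)%R y).
  rewrite /=; apply/matrixP => i j; rewrite !mxE; ring.
have := lip_norm_lt (exist _ 0 (mem_set X0) : X) gh x y.
move=> /(le_trans (norm_le_enorm _))/le_trans => /(_ ((e - c) / 2 * `|val x - val y|)) H.
rewrite (le_trans (ler_normD _ _))//.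
have : `|(g \- h)%R x - (g \- h)%R y| <= (e - c) / 2 * `|val x - val y|.
  apply: H; rewrite [leRHS](_ : _ = (e - c) / (2 * N%:R) * (N%:R * `|val x - val y|)).
    by rewrite ler_wpM2l ?enorm_le_norm// divr_ge0 ?(ltW ec)// mulr_ge0.
  by field; rewrite gt_eqF.
have := hc x y; lra.
Qed.

End perturbations.

(** * Hoelder inverses against the rates of the layers *)

Section obstruction.
Variables (R : realType) (k N : nat) (r l : nat -> R) (X : set 'rV[R]_N).
Variable P : {set 'I_N} -> nat -> set 'rV[R]_N.
Hypotheses (lr : forall i, (1 <= i)%N -> 0 < l i <= r i)
  (Pmax : forall (J : {set 'I_N}) i, #|J| = k.+1 -> (1 <= i)%N ->
        max_card_separated_in (l i) (sphere J (r i)) (P J i))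
  (PX : forall (J : {set 'I_N}) i x, #|J| = k.+1 -> (1 <= i)%N -> P J i x -> X x)
  (X0 : X 0).

Let x0 : X := exist _ 0 (mem_set X0).

Lemma near_full_rank_almost_zero (phi : X -> 'rV[R]_k) : near_full_rank phi ->
  exists2 C : R, 0 < C & forall i, (1 <= i)%N ->
    exists2 x : X, enorm (val x) = r i & enorm (phi x0 - phi x) <= C * l i.
Proof.
move=> [A [J [e [C [c [cJ C0 eC ce phic]]]]]].
(* The factor [k] converts the sup norm to [enorm]; the added 1 makes positivity immediate. *)
exists ((k%:R + 1) * C) => [|i i1]; first by rewrite mulr_gt0// ltr_wpDl.
have /andP[l0 lri] := lr i1; have r0 : 0 < r i := lt_le_trans l0 lri.
have [PS Psep] := (Pmax cJ i1).1.
(* The nonlinear part of [phi]; outside [X] the map [phi] is read at the default point [x0], but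
   only points of [X] are used. *)
pose G (x : 'rV[R]_N) : 'rV[R]_k := phi (insubd x0 x) - x *m A.
have valX x : X x -> val (insubd x0 x) = x by move=> Xx; rewrite insubdK//; exact: mem_set.
have net x : sphere J (r i) x -> exists2 p, P J i p & `|x - p| <= l i.
  move=> /(maximal_net cJ r0 (lr i1) (Pmax cJ i1))[p Pp xp].
  by exists p => //; rewrite (le_trans (norm_le_enorm _))// ltW.
have PX0 z : (P J i `|` [set 0]) z -> X z by move=> [/(PX cJ i1)//|->].
have [x y Px Py|p Pp] := eC (r i) (l i) (P J i) r0 l0 PS net G.
  have := phic (insubd x0 x) (insubd x0 y); rewrite !valX; [|exact: PX0..].
  by move=> /le_trans; apply; rewrite ler_wpM2r// ltW.
have Xp := PX cJ i1 Pp.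
move=> pC; exists (insubd x0 p); first by rewrite valX// (PS _ Pp).1.
rewrite enormB_C (le_trans (enorm_le_norm _))//.
have Cl : 0 <= C * l i by rewrite mulr_ge0 ?ltW.
have E : phi (insubd x0 p) - phi x0 = p *m A + (G p - G 0).
  rewrite /G mul0mx subr0 (_ : insubd x0 0 = x0); last by apply: val_inj; rewrite valX.
  by rewrite addrA (addrC (p *m A)) subrK.
rewrite E -mulrA mulrDl mul1r ler_wpDr// ler_wpM2l//.
Qed.

(** The Hoelder bound at the image of the origin reads r_i <= c (C l_i)^a. Taking logarithms leaves
    a comparison of the rates alone. *)
Lemma near_full_rank_holder (phi : X -> 'rV[R]_k) (a : R) : near_full_rank phi ->
  0 < a -> injective_with_holder_inverse a phi setT ->
  exists D : R, forall i, (1 <= i)%N -> ln (r i) <= D + a * ln (l i).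
Proof.
move=> /near_full_rank_almost_zero[C C0 phiC] a0 [_ [psi [psiK hol]]].
have [|c c0 cP] := hol (phi x0); first by exists x0.
exists (ln c + a * ln C) => i i1.
have /andP[l0 lri] := lr i1; have r0 : 0 < r i := lt_le_trans l0 lri.
have [x xr xC] := phiC i i1.
have := cP (phi x); rewrite !psiK// => /(_ (ex_intro2 _ _ x I erefl)).
rewrite /= enormB_C subr0 xr => ri.
have : r i <= c * (C * l i) `^ a.
  rewrite (le_trans ri)// ler_wpM2l ?(ltW c0)// ge0_ler_powR ?(ltW a0)// nnegrE ?enorm_ge0//.
  by rewrite mulr_ge0 ?ltW.
rewrite -ler_ln ?posrE ?mulr_gt0 ?powR_gt0 ?mulr_gt0//.
rewrite lnM ?posrE ?powR_gt0 ?mulr_gt0// ln_powR lnM ?posrE// mulrDr addrA.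
exact.
Qed.

End obstruction.

Lemma holder_rate_square (R : realType) (r l : nat -> R) (a D : R) : 0 < a ->
  (forall i, (1 <= i)%N -> r i = 2 ^- i /\ l i = 2 ^- (i ^ 2)) ->
  ~ forall i, (1 <= i)%N -> ln (r i) <= D + a * ln (l i).
Proof.
move=> a0 rlE H; have l20 : 0 < ln 2 :> R by rewrite ln_gt0// ltr1n.
(* Beyond [M] one has a i > 1 + |D| / ln 2; multiplied by i ln 2, this makes a i^2 ln 2 exceed i ln
   2 + D. *)
pose M := (1 + `|D| / ln 2) / a.
have M0 : 0 <= M by rewrite divr_ge0 ?(ltW a0)// addr_ge0// divr_ge0 ?(ltW l20).
pose i := (Num.truncn M).+1.
have /andP[_ Mi] := truncn_itv M0.
have := H i isT; have [-> ->] := rlE i isT.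
rewrite !lnV ?posrE ?exprn_gt0// !lnXn// -[ln 2 *+ i]mulr_natl -[ln 2 *+ _]mulr_natl natrX.
have ai : 1 + `|D| / ln 2 < a * i%:R by rewrite [ltRHS]mulrC -ltr_pdivrMr.
have Dl : D <= (`|D| / ln 2) * ln 2 by rewrite divfK ?gt_eqF// ler_norm.
have i1 : 1 <= i%:R :> R by rewrite ler1n.
have q0 : 0 <= `|D| / ln 2 by rewrite divr_ge0 ?(ltW l20).
set q := `|D| / ln 2 in ai Dl q0.
have : 0 < (a * i%:R - 1 - q) * (i%:R * ln 2).
  by rewrite mulr_gt0 ?mulr_gt0 ?ltr0n//; lra.
have : 0 <= (i%:R - 1) * (q * ln 2) by rewrite mulr_ge0 ?subr_ge0// mulr_ge0// ltW.
lra.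
Qed.

Lemma holder_rate_linear (R : realType) (r l : nat -> R) (a t D : R) : 1 < a * t ->
  (forall i, (1 <= i)%N -> r i = 2 ^- i /\ l i = 2 `^ (- (i%:R * t))) ->
  ~ forall i, (1 <= i)%N -> ln (r i) <= D + a * ln (l i).
Proof.
move=> at1 rlE H; have l20 : 0 < ln 2 :> R by rewrite ln_gt0// ltr1n.
have c0 : 0 < (a * t - 1) * ln 2 by rewrite mulr_gt0// subr_gt0.
(* The assumed bounds say i (a t - 1) ln 2 <= D, which fails for i > M. *)
pose M := `|D| / ((a * t - 1) * ln 2).
have M0 : 0 <= M by rewrite divr_ge0 ?(ltW c0).
pose i := (Num.truncn M).+1.
have /andP[_ Mi] := truncn_itv M0.
have := H i isT; have [-> ->] := rlE i isT.
rewrite lnV ?posrE ?exprn_gt0// lnXn// ln_powR -[ln 2 *+ i]mulr_natl.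
move: Mi; rewrite /M ltr_pdivrMr// -/i => Mi.
have := ler_norm D; lra.
Qed.

(** A point of [X] missing from [A] would lie in a null set, yet its singleton is closed, hence
    Borel, and has positive mass. *)
Lemma full_measure_atoms (R : realType) (n : nat)
    (mu : {finite_measure set (borel_rV R n) -> \bar R})
    (X : set 'rV[R]_n) (A : set X) :
  supported_with_atoms mu X -> full_measure_in mu A -> A = setT.
Proof.
move=> [_ atoms] [B [mB B0 AB]]; apply/seteqP; split=> // x _.
apply: contrapT => nAx.
have mx : measurable ([set val x] : set (borel_rV R n)).
  rewrite -[[set _]]setCK; apply: measurableC; apply: sub_sigma_algebra.
  apply: closed_openC; apply: accessible_closed_set1; apply: hausdorff_accessible.
  exact: norm_hausdorff.
have := atoms _ (set_valP x); rewrite ltNge => /negP; apply.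
rewrite -B0 le_measure ?inE// => _ ->; apply: AB => -[y Ay /val_inj yx].
by apply: nAx; rewrite -yx.
Qed.

Theorem proposition6p2 (R : realType) (k N : nat) (hk : (1 <= k)%N)
    (hkN : (k < N)%N) (r l : nat -> R) (hrl : admissible_sequences r l)
    (X : set 'rV[R]_N) (hX : layered_set k r l X) :
  exists U : set (X -> 'rV[R]_k),
    [/\ lip_open U,
        forall L : {linear 'rV[R]_N -> 'rV[R]_k},
          \rank (lin1_mx L) = k -> U (fun x : X => L (val x)),
        (forall i, (1 <= i)%N -> r i = 2 ^- i /\ l i = 2 ^- (i ^ 2)) ->
        [/\ hausdorff_dim X = 0%E,
            forall phi, U phi -> forall a : R, 0 < a ->
              ~ injective_with_holder_inverse a phi setT
          & forall mu : {finite_measure set (borel_rV R N) -> \bar R},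
              supported_with_atoms mu X ->
              forall phi, U phi -> forall a : R, 0 < a ->
              ~ exists2 A : set X, full_measure_in mu A &
                  injective_with_holder_inverse a phi A]
      & forall s t : R, 0 < s < k%:R -> t = k%:R / (k%:R - s) ->
        (forall i, (1 <= i)%N ->
          r i = 2 ^- i /\ l i = 2 `^ (- (i%:R * t))) ->
        [/\ lower_box_dim X = s%:E /\ upper_box_dim X = s%:E,
            forall phi, U phi -> forall a : R,
              (1 - upper_box_dim X * (k%:R^-1)%:E < a%:E)%E ->
              ~ injective_with_holder_inverse a phi setT
          & forall mu : {finite_measure set (borel_rV R N) -> \bar R},
              supported_with_atoms mu X ->
              forall phi, U phi -> forall a : R,
              (1 - upper_box_dim X * (k%:R^-1)%:E < a%:E)%E ->
              ~ exists2 A : set X, full_measure_in mu A &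
                  injective_with_holder_inverse a phi A]].
Proof.
have [P [Pmax PX X0 XP exJ]] := layered_setP hkN hrl hX.
have [lr _ _ _] := hrl.
have N0 : (0 < N)%N := leq_ltn_trans (leq0n _) hkN.
exists (@lip_near_full_rank R k N X); split.
- exact: lip_open_near_full_rank.
- by move=> L; exact: lip_near_full_rank_linear.
- move=> rlE.
  have noinv (phi : X -> 'rV[R]_k) : lip_near_full_rank phi -> forall a : R, 0 < a ->
      ~ injective_with_holder_inverse a phi setT.
    move=> [_ phiU] a a0 /(near_full_rank_holder lr Pmax PX X0 phiU a0)[D].
    exact: holder_rate_square.
  split=> //; first exact/hausdorff_dim_countable/(layered_countable lr Pmax XP).
  move=> mu mux phi phiU a a0 [A /(full_measure_atoms mux)->].
  exact: noinv.
- move=> s t sk tE rlE; have /andP[s0 s1] := sk.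
  have us := layered_upper_box_dim lr Pmax XP sk tE rlE.
  have ls := layered_lower_box_dim lr Pmax PX sk tE rlE exJ.
  have lu := lower_le_upper_box_dim X.
  have uE : upper_box_dim X = s%:E.
    by apply/eqP; rewrite eq_le us (le_trans ls lu).
  have lE : lower_box_dim X = s%:E.
    by apply/eqP; rewrite eq_le ls (le_trans lu us).
  have noinv (phi : X -> 'rV[R]_k) : lip_near_full_rank phi -> forall a : R,
      (1 - upper_box_dim X * (k%:R^-1)%:E < a%:E)%E ->
      ~ injective_with_holder_inverse a phi setT.
    have k0 : 0 < k%:R :> R by rewrite ltr0n.
    have ks0 : 0 < k%:R - s by rewrite subr_gt0.
    move=> [_ phiU] a; rewrite uE -EFinM -EFinB lte_fin => sa.
    (* The threshold is 1 / t, so the condition on [a] is a t > 1, as [holder_rate_linear]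
       requires. *)
    have sk1 : 1 - s / k%:R = (k%:R - s) / k%:R by field; rewrite gt_eqF.
    have a0 : 0 < a by rewrite (lt_trans _ sa)// sk1 divr_gt0.
    move=> /(near_full_rank_holder lr Pmax PX X0 phiU a0)[D].
    apply: holder_rate_linear rlE.
    rewrite tE mulrA ltr_pdivlMr// mul1r -ltr_pdivrMr//.
    by rewrite -sk1.
  split=> // mu mux phi phiU a a0 [A /(full_measure_atoms mux)->].
  exact: noinv.
Qed.
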